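(* Let $\mathcal{P}$ be the Petersen graph. Then $L(\mathcal{P})$ has a proper Galvin orientation with respect to $\chi'(\mathcal{P})=4$.
   Context: A $k$-edge-colouring is an assignment of colours from $\{1,\dots,k\}$ to edges so that adjacent edges get different colours; $\chi'$ is the chromatic index. The line graph $L(G)$ has vertex set $E(G)$, and two edges $e,f$ of $G$ are joined in $L(G)$ by as many edges as the number of ends they share in $G$; each edge of $L(G)$ corresponds to a common incidence of its two ends at a vertex of $G$. Given a partition of $V(G)$ into sets $U$ and $D$ and a $k$-edge-colouring $\varphi$ of $G$, the Galvin orientation of $L(G)$ is defined as follows: for an edge of $L(G)$ with ends $e_1,e_2$, where $\varphi(e_1)<\varphi(e_2)$, corresponding to a common incidence at a vertex $x$ of $G$: if $x\in D$ it is oriented from $e_2$ to $e_1$, and if $x\in U$ it is oriented from $e_1$ to $e_2$. A kernel of a digraph is an independent set $K$ such that every vertex outside $K$ has an out-edge into $K$; a digraph is kernel-perfect if every induced subdigraph has a kernel. The Galvin orientation is proper if it is kernel-perfect and every vertex has outdegree at most $k-1$. $L(G)$ has a proper Galvin orientation with respect to $k$ if there exist a partition $(U,D)$ of $V(G)$ and a $k$-edge-colouring $\varphi$ of $G$ whose Galvin orientation is proper. *)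

(* Defs.v *)
From mathcomp Require Import all_boot all_algebra.

Set Implicit Arguments.
Unset Strict Implicit.
Unset Printing Implicit Defensive.

Import GRing.Theory.

(* Finite loopless graphs; distinct edges may have the same pair of ends. *)
Record mgraph := MGraph {
  vert : finType;
  edge : finType;
  ends : edge -> {set vert};
  card_ends : forall e, #|ends e| = 2
}.

(* Finite digraphs, parallel arcs allowed. *)
Record digraph := Digraph {
  dvert : finType;
  arc : finType;
  tail : arc -> dvert;
  head : arc -> dvert
}.

Section Colouring.
Variable G : mgraph.

(* The colours are 0, ..., k-1 (in place of 1, ..., k), with their order. *)
Definition edge_colouring k (phi : {ffun edge G -> 'I_k}) : bool :=
  [forall e : edge G, forall f : edge G,
     (e != f) && (ends e :&: ends f != set0) ==> (phi e != phi f)].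

Definition edge_colourable k : bool :=
  [exists phi : {ffun edge G -> 'I_k}, edge_colouring phi].

Lemma edge_colourable_ex : exists k, edge_colourable k.
Proof.
exists #|edge G|; apply/existsP; exists [ffun e => enum_rank e].
apply/forallP=> e; apply/forallP=> f; apply/implyP=> /andP[nef _].
by rewrite !ffunE (inj_eq enum_rank_inj).
Qed.

Definition chromatic_index : nat := ex_minn edge_colourable_ex.

End Colouring.

Section Kernels.
Variable Q : digraph.

(* K is a kernel of the subdigraph of Q induced by S. *)
Definition kernel_of (S K : {set dvert Q}) : Prop :=
  [/\ K \subset S,
      forall a : arc Q, ~ (tail a \in K /\ head a \in K)
    & forall v, v \in S -> v \notin K ->
        exists a : arc Q, tail a = v /\ head a \in K].

Definition kernel_perfect : Prop :=
  forall S : {set dvert Q}, exists K : {set dvert Q}, kernel_of S K.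

Definition outdegree (v : dvert Q) : nat := #|[set a : arc Q | tail a == v]|.

End Kernels.

Section LineGraph.
Variable G : mgraph.

(* An edge of L(G) is a pair of distinct edges of G together with a vertex
   of G at which both are incident. *)
Definition line_edge : pred ({set edge G} * vert G) :=
  fun p => (#|p.1| == 2) && [forall e in p.1, p.2 \in ends e].

Definition line_ends (a : {p | line_edge p}) : {set edge G} := (val a).1.

Lemma card_line_ends a : #|line_ends a| = 2.
Proof. by case: a => p /= P; case/andP: (P) => /eqP. Qed.

Definition line_graph : mgraph := MGraph card_line_ends.

Lemma line_graph_mult (e f : edge G) : e != f ->
  #|[set a : edge line_graph | ends a == [set e; f]]| = #|ends e :&: ends f|.
Proof.
move=> nef; set A := [set a | _].
rewrite -(card_imset A (val_inj : injective (val : edge line_graph -> _))).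
rewrite -(card_imset (ends e :&: ends f) (_ : injective (pair [set e; f])));
  last by move=> x y [].
congr #|pred_of_set _|; apply/setP=> -[B x]; apply/imsetP/imsetP.
- case=> -[[C y] Cy]; rewrite inE /= /line_ends /= => /eqP CE [EB Ex]; subst B x.
  exists y; last by rewrite CE.
  case/andP: Cy => _ /forallP /= H; have := H e; have := H f.
  by rewrite CE !inE !eqxx orbT /= => -> ->.
- case=> y; rewrite inE => /andP[ye yf] [-> ->].
  have Hy : line_edge ([set e; f], y).
    rewrite /line_edge /= cards2 nef /=; apply/forallP=> g; apply/implyP.
    by rewrite !inE => /orP[] /eqP->.
  by exists (Sub _ Hy) => //; rewrite inE /=.
Qed.

(* A triple (e, f, x) is the edge of L(G) with ends e and f that arises at
   the vertex x, directed from e to f. *)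
Definition galvin_arc k (U D : {set vert G}) (phi : {ffun edge G -> 'I_k}) :
    pred (edge G * edge G * vert G) :=
  fun t => let: (e, f, x) := t in
    [&& e != f, x \in ends e, x \in ends f
      & (x \in D) && (phi f < phi e) || (x \in U) && (phi e < phi f)].

Definition galvin_orientation k (U D : {set vert G})
    (phi : {ffun edge G -> 'I_k}) : digraph :=
  @Digraph (edge G) {t | galvin_arc U D phi t}
    (fun a => (val a).1.1) (fun a => (val a).1.2).

Definition bipartition (U D : {set vert G}) : Prop :=
  U :|: D = [set: vert G] /\ U :&: D = set0.

(* Each edge of L(G) occurs in exactly one of its two directions. *)
Lemma galvin_arc_orient k U D (phi : {ffun edge G -> 'I_k}) e f x :
    bipartition U D -> edge_colouring phi -> line_edge ([set e; f], x) ->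
  galvin_arc U D phi (e, f, x) (+) galvin_arc U D phi (f, e, x).
Proof.
move=> [UD1 UD0] /forallP/(_ e)/forallP/(_ f) cphi /andP[/= ef /forallP H].
have nef : e != f by move: ef; rewrite cards2; case: (e != f).
have xe : x \in ends e by have:= H e; rewrite !inE eqxx.
have xf : x \in ends f by have:= H f; rewrite !inE eqxx orbT.
move: cphi; rewrite nef /= => /implyP cphi.
have {}cphi : phi e != phi f by apply: cphi; apply/set0Pn; exists x; rewrite inE xe.
rewrite (eq_sym f e) nef xe xf /=.
have xUD : x \in U :|: D by rewrite UD1 inE.
have xnUD : x \notin U :&: D by rewrite UD0 inE.
move: xUD xnUD; rewrite !inE.
have : (phi e : nat) != phi f by rewrite val_eqE.
by case: (x \in U); case: (x \in D); case: ltngtP.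
Qed.

Definition proper_galvin k (U D : {set vert G})
    (phi : {ffun edge G -> 'I_k}) : Prop :=
  kernel_perfect (galvin_orientation U D phi) /\
  forall e : dvert (galvin_orientation U D phi), outdegree e <= k - 1.

Definition has_proper_galvin_orientation k : Prop :=
  exists U D : {set vert G}, exists phi : {ffun edge G -> 'I_k},
    [/\ bipartition U D, edge_colouring phi & proper_galvin U D phi].

End LineGraph.

(* Vertices (false, i) form the outer pentagon and vertices (true, i) the
   inner pentagram; the three summands of the edge type index the outer
   edges, the spokes and the inner edges. Indices are taken modulo 5. *)
Definition petersen_ends (e : 'Z_5 + 'Z_5 + 'Z_5) : {set bool * 'Z_5} :=
  match e with
  | inl (inl i) => [set (false, i); (false, i + 1)%R]
  | inl (inr i) => [set (false, i); (true, i)]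
  | inr i => [set (true, i); (true, i + 2%:R)%R]
  end.

Lemma card_petersen_ends e : #|petersen_ends e| = 2.
Proof.
by case: e => [[i|i]|i]; rewrite /= cards2 xpair_eqE //= -{1}[i]addr0
  (inj_eq (addrI i)).
Qed.

Definition petersen : mgraph := MGraph card_petersen_ends.

(* Main.v *)
(** Kernel-perfectness: a sink of a digraph may be put into the kernel and
    deleted together with its in-neighbours, and a source may be deleted and
    afterwards added to the kernel if it is not yet dominated.  So only the
    induced subdigraphs in which all in- and outdegrees are positive matter.
    For the colouring and partition below, the line graph of the Petersen graph
    has 17 of them that are not empty, and each has one of four independent sets
    as a kernel. *)
From mathcomp Require Import all_boot all_algebra.
Require Import Defs.

Set Implicit Arguments.
Unset Strict Implicit.
Unset Printing Implicit Defensive.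

(** * Reduction to induced subdigraphs without sinks and sources *)

Lemma kernel_perfect_no_sink_source (Q : digraph) :
  (forall S : {set dvert Q},
     (forall v, v \in S -> exists2 a : arc Q, tail a = v & head a \in S) ->
     (forall v, v \in S -> exists2 a : arc Q, head a = v & tail a \in S) ->
     exists K, kernel_of S K) ->
  kernel_perfect Q.
Proof.
move=> core S; have [n] := ubnP #|S|; elim: n S => // n IH S; rewrite ltnS => leSn.
have smaller v (T : {set dvert Q}) : v \in S -> T \subset S :\ v ->
    exists K, kernel_of T K.
  move=> vS sTS; apply: IH; apply: leq_trans leSn.
  by apply: leq_ltn_trans (subset_leq_card sTS) _; rewrite [ltnRHS](cardsD1 v) vS.
have [out|] := boolP [forall v in S, exists a : arc Q, (tail a == v) && (head a \in S)].
  have [inn|] := boolP [forall v in S, exists a : arc Q, (head a == v) && (tail a \in S)].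
    apply: core => v vS.
      by have /existsP[a /andP[/eqP ? ?]] := forall_inP out v vS; exists a.
    by have /existsP[a /andP[/eqP ? ?]] := forall_inP inn v vS; exists a.
  case/forall_inPn=> v vS /existsPn source.
  have [K [sK indK domK]] := smaller v _ vS (subxx _).
  have sKS : K \subset S by apply: subset_trans sK (subsetDl _ _).
  have [/existsP[a /andP[/eqP av aK]]|/existsPn free] :=
    boolP [exists a : arc Q, (tail a == v) && (head a \in K)].
    exists K; split=> // w wS wK; have [->|nwv] := eqVneq w v; first by exists a.
    by apply: domK => //; rewrite !inE nwv.
  (* Arcs from [S] into [v], loops included, are excluded because [v] is a source, and arcs from [v]
     into [K] by [free]. *)
  exists (v |: K); split.
  - by rewrite subUset sub1set vS.
  - move=> a []; rewrite !inE => ta /predU1P[ha|ha].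
      have /negP[] := source a; rewrite ha eqxx /=.
      by case/predU1P: ta => [->|/(subsetP sKS)].
    case/predU1P: ta => ta; last exact: (indK a).
    by have /negP[] := free a; rewrite ta eqxx.
  - move=> w wS; rewrite !inE negb_or => /andP[nwv wK].
    have [|a [ta ha]] := domK w _ wK; first by rewrite !inE nwv.
    by exists a; rewrite !inE ha orbT.
case/forall_inPn=> v vS /existsPn sink.
pose T := [set u in S :\ v | [forall a : arc Q, (tail a == u) ==> (head a != v)]].
have sT : T \subset S :\ v by apply/subsetP=> u; rewrite inE => /andP[].
have [K [sK indK domK]] := smaller v T vS sT.
have sKS : K \subset S.
  by apply: subset_trans sK (subset_trans sT _); apply: subsetDl.
(* No arc leads from the sink [v] into [S], the choice of [T] excludes arcs from [K] to [v], and
   every deleted vertex other than [v] has an arc to [v]. *)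
exists (v |: K); split.
- by rewrite subUset sub1set vS.
- move=> a []; rewrite !inE => /predU1P[ta|ta] ha.
    have /negP[] := sink a; rewrite ta eqxx /=.
    by case/predU1P: ha => [->|/(subsetP sKS)].
  case/predU1P: ha => ha; last exact: (indK a).
  have := subsetP sK _ ta; rewrite inE => /andP[_ /forallP/(_ a)].
  by rewrite eqxx ha eqxx.
- move=> w wS; rewrite !inE negb_or => /andP[nwv wK].
  have [/forallP wT|/forallPn[a]] :=
    boolP [forall a : arc Q, (tail a == w) ==> (head a != v)].
    have [|a [ta ha]] := domK w _ wK; last by exists a; rewrite !inE ha orbT.
    by rewrite !inE nwv wS; apply/forallP.
  by rewrite negb_imply negbK => /andP[/eqP ta /eqP ha]; exists a; rewrite ha !inE eqxx.
Qed.

(** * Exhaustive search over subsets and over colourings *)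

Section SubsetSearch.
Variables (T : eqType) (test : seq T -> seq T -> bool).

(* [if] prunes the search where the strict [||] would not: [vm_compute] is
   call-by-value. *)
Fixpoint decide (vs ins outs : seq T) : bool :=
  if test ins outs then true else
  if vs is v :: vs' then decide vs' (v :: ins) outs && decide vs' ins (v :: outs)
  else false.

(** Following the branch that answers each membership question as [S] does, the search must stop at
    a node where [test] succeeds. *)
Lemma decideP (S : pred T) vs ins outs :
    decide vs ins outs -> all S ins -> all (predC S) outs ->
  exists ins' outs', [/\ test ins' outs', all S ins' & all (predC S) outs'].
Proof.
elim: vs ins outs => [|v vs IH] ins outs /=; have [t|_] := boolP (test ins outs) => //;
  try by exists ins, outs.
case/andP=> din dout Sin Sout.
have [Sv|nSv] := boolP (S v); first by apply: IH din _ _; rewrite //= Sv.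
by apply: IH dout _ _; rewrite //= nSv.
Qed.

End SubsetSearch.

Section ColourSearch.
Variables (T : eqType) (adj : rel T) (k : nat).

Fixpoint extendable (es : seq T) (partial : seq (T * nat)) : bool :=
  if es is e :: es' then
    has (fun c => if all (fun p => adj e p.1 ==> (c != p.2)) partial
                  then extendable es' ((e, c) :: partial) else false) (iota 0 k)
  else true.

(** The branch that gives every edge its colour under [col] never meets a clash; hence a failed
    search refutes colourability. *)
Lemma extendable_colouring (col : T -> nat) es fs :
    (forall e, col e < k) -> (forall e f, adj e f -> col e != col f) ->
  extendable es [seq (f, col f) | f <- fs].
Proof.
move=> ltk proper; elim: es fs => //= e es IH fs.
apply/hasP; exists (col e); first by rewrite mem_iota ltk.
rewrite (IH (e :: fs)) all_map ifT //; apply/allP=> f _ /=.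
by apply/implyP; apply: proper.
Qed.

End ColourSearch.

(** * The Petersen graph in computable form *)

Notation pvert := (bool * 'Z_5)%type.
Notation pedge := ('Z_5 + 'Z_5 + 'Z_5)%type.

(* Finite sets and enumerations are opaque to computation, hence sequences. *)
Definition end_seq (e : pedge) : seq pvert :=
  match e with
  | inl (inl i) => [:: (false, i); (false, i + 1)%R]
  | inl (inr i) => [:: (false, i); (true, i)]
  | inr i => [:: (true, i); (true, i + 2%:R)%R]
  end.

Definition Z5_seq : seq 'Z_5 := [seq inZp i | i <- iota 0 5].

Definition edge_seq : seq pedge :=
  [seq inl (inl i) | i <- Z5_seq] ++ [seq inl (inr i) | i <- Z5_seq]
  ++ [seq inr i | i <- Z5_seq].

Lemma mem_end_seq e x : (x \in petersen_ends e) = (x \in end_seq e).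
Proof. by case: e => [[i|i]|i]; rewrite !inE. Qed.

Lemma mem_Z5_seq i : i \in Z5_seq.
Proof.
apply/mapP; exists (i : nat); last by rewrite valZpK.
by rewrite mem_iota; apply: (ltn_ord i).
Qed.

Lemma mem_edge_seq e : e \in edge_seq.
Proof.
rewrite !mem_cat; apply/or3P.
by case: e => [[i|i]|i]; [constructor 1|constructor 2|constructor 3];
  apply: map_f; apply: mem_Z5_seq.
Qed.

Lemma all_edge_seq (P : pred pedge) : all P edge_seq -> forall e, P e.
Proof. by move/allP=> H e; apply/H/mem_edge_seq. Qed.

Definition meets (e f : pedge) : bool :=
  (e != f) && has (mem (end_seq f)) (end_seq e).

Lemma meetsE e f :
  (e != f) && (petersen_ends e :&: petersen_ends f != set0) = meets e f.
Proof.
congr andb; apply/set0Pn/hasP => [[x]|[x xe xf]].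
  by rewrite inE !mem_end_seq => /andP[]; exists x.
by exists x; rewrite inE !mem_end_seq xe.
Qed.

(** * Three colours do not suffice *)

Lemma petersen_not_extendable k : k < 4 -> ~~ extendable meets k edge_seq [::].
Proof. by case: k => [|[|[|[|]]]] // _; vm_compute. Qed.

Lemma petersen_not_colourable k : k < 4 -> ~~ edge_colourable petersen k.
Proof.
move=> ltk4; apply: contra (petersen_not_extendable ltk4) => /existsP[phi /forallP col].
apply: (@extendable_colouring _ _ _ (fun e => phi e) _ [::]) => // e f.
by rewrite -meetsE; have /forallP/(_ f)/implyP := col e.
Qed.

(** * The 4-edge-colouring, the partition and the resulting orientation *)

Definition colour (e : pedge) : nat :=
  match e with
  | inl (inl i) => nth 0 [:: 3; 0; 3; 1; 2] i
  | inl (inr i) => nth 0 [:: 1; 1; 2; 2; 0] i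
  | inr i => nth 0 [:: 3; 3; 1; 0; 2] i
  end.

Definition down (x : pvert) : bool :=
  nth false (if x.1 then [:: true; false; false; true; true]
             else [:: false; true; true; false; true]) x.2.

Definition phi4 : {ffun edge petersen -> 'I_4} := [ffun e => inZp (colour e)].
Definition downset : {set vert petersen} := [set x | down x].

Lemma phi4E e : phi4 e = colour e :> nat.
Proof.
rewrite ffunE /=; apply: modn_small.
by move: e; apply: all_edge_seq; vm_compute.
Qed.

Lemma edge_colouring_phi4 : edge_colouring phi4.
Proof.
apply/forallP=> e; apply/forallP=> f; rewrite meetsE -val_eqE /= !phi4E.
move: f; apply: all_edge_seq; move: e; apply: all_edge_seq.
by vm_compute.
Qed.

Definition arcs_at (e f : pedge) : seq pvert :=
  [seq x <- end_seq e | [&& e != f, x \in end_seq f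
    & if down x then colour f < colour e else colour e < colour f]].

Lemma galvin_arcE e f x :
  galvin_arc (~: downset) downset phi4 (e, f, x) = (x \in arcs_at e f).
Proof.
rewrite mem_filter /= !mem_end_seq !phi4E !inE.
by case: (e != f); case: (down x); case: (x \in end_seq e); rewrite ?andbF ?orbF ?andbT.
Qed.

Definition petersen_orientation : digraph :=
  galvin_orientation (~: downset) downset phi4.

Definition arrow (e f : pedge) : bool := arcs_at e f != [::].

Lemma arrowP (e f : pedge) :
  reflect (exists2 a : arc petersen_orientation, tail a = e & head a = f)
    (arrow e f).
Proof.
rewrite /arrow; apply: (iffP idP) => [|[[[[e' f'] x] a] /= <- <-]].
  case E: (arcs_at e f) => [//|x s] _.
  have a : galvin_arc (~: downset) downset phi4 (e, f, x).
    by rewrite galvin_arcE E mem_head.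
  by exists (Sub (e, f, x) a).
by move: a; rewrite galvin_arcE; case: arcs_at.
Qed.

(** The arcs out of [e] inject into an explicit list of triples, whose length is computed for each
    of the 15 edges. *)
Lemma outdegree_le3 (e : dvert petersen_orientation) : outdegree e <= 3.
Proof.
pose s := [seq (e, f, x) | f <- edge_seq, x <- arcs_at e f].
rewrite /outdegree -(card_imset _ val_inj); apply: (@leq_trans (size s)).
  apply: leq_trans (card_size s); apply: subset_leq_card; apply/subsetP=> t.
  case/imsetP=> -[[[e' f] x] a]; rewrite inE /= => /eqP e'E ->.
  rewrite /= in e'E; subst e'.
  by apply/allpairsPdep; exists f, x; rewrite mem_edge_seq -galvin_arcE.
rewrite size_allpairs_dep {s}.
by move: e; apply: all_edge_seq; vm_compute.
Qed.

(** * Kernel-perfectness by search over sets of edges *)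

(* The subset search runs on positions in [edge_seq] and tabulated adjacency:
   evaluating [arrow] at every node of the search tree is too slow. *)
Definition edge_at (i : nat) : pedge := nth (inr ord0) edge_seq i.
Definition edge_pos (e : pedge) : nat := index e edge_seq.

Lemma edge_posK : cancel edge_pos edge_at.
Proof. by move=> e; apply: nth_index; apply: mem_edge_seq. Qed.

Lemma edge_pos_lt e : edge_pos e < 15.
Proof. by have := mem_edge_seq e; rewrite -index_mem. Qed.

Definition table (r : rel pedge) : seq (seq nat) :=
  [seq [seq j <- iota 0 15 | r (edge_at i) (edge_at j)] | i <- iota 0 15].

Definition lookup (t : seq (seq nat)) (i : nat) : seq nat := nth [::] t i.

Lemma mem_lookup r i j :
  (j \in lookup (table r) i) = [&& i < 15, j < 15 & r (edge_at i) (edge_at j)].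
Proof.
rewrite /lookup; have [lti|lei] := ltnP i 15; last first.
  by rewrite nth_default ?size_map ?size_iota.
by rewrite (nth_map 0) ?size_iota // nth_iota // mem_filter mem_iota andbC.
Qed.

(* Kernels of all induced subdigraphs without sinks and sources, found by
   computer search; the empty one settles the empty subdigraph. *)
Definition kernels : seq (seq nat) :=
  [:: [::]; [:: 0; 2; 10; 11]; [:: 0; 10; 14]; [:: 2; 4; 10]; [:: 0; 2; 10; 14]].

(** A certificate for all sets that contain [ins] and avoid [outs] at once: some member is a sink,
    some member is a source, or a listed [K] lies inside and absorbs every position not yet
    excluded. *)
Definition settled (succs preds : seq (seq nat)) (ins outs : seq nat) : bool :=
  [|| has (fun i => all (mem outs) (lookup succs i)) ins,
      has (fun i => all (mem outs) (lookup preds i)) ins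
    | has (fun K => all (mem ins) K
            && all (fun i => [|| i \in K, i \in outs | has (mem K) (lookup succs i)])
                 (iota 0 15)) kernels].

Lemma kernels_independent :
  all (fun K => all (fun i => all (fun j => ~~ arrow (edge_at i) (edge_at j)) K) K)
    kernels.
Proof. by vm_compute. Qed.

Lemma decide_settled :
  decide (settled (table arrow) (table (fun e f => arrow f e))) (iota 0 15) [::] [::].
Proof. by vm_compute. Qed.

Lemma kernel_perfect_petersen : kernel_perfect petersen_orientation.
Proof.
apply: kernel_perfect_no_sink_source => S out inn.
(* The bound [i < 15] keeps out positions where [edge_at] returns its default edge. *)
have [] // := decideP (S := fun i => (i < 15) && (edge_at i \in S)) decide_settled.
move=> ins [outs [/or3P test /allP insS /allP outsS]].
have posS e : e \in S -> edge_pos e \notin outs.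
  by move=> eS; apply/negP=> /outsS; rewrite /= edge_pos_lt edge_posK eS.
case: test => /hasP[].
(* By [out] there is a successor in [S], yet all successors lie in [outs], hence outside [S]; the
   source case is dual. *)
- move=> i /insS /andP[lti /out[a ta ha]] /allP/(_ (edge_pos (head a))) /=.
  rewrite mem_lookup lti edge_pos_lt edge_posK /=.
  rewrite (negPf (posS _ ha)) => /(_ _)/notF[].
  by apply/arrowP; exists a.
- move=> i /insS /andP[lti /inn[a ha ta]] /allP/(_ (edge_pos (tail a))) /=.
  rewrite mem_lookup lti edge_pos_lt edge_posK /=.
  rewrite (negPf (posS _ ta)) => /(_ _)/notF[].
  by apply/arrowP; exists a.
move=> K KK /andP[/allP Kins /allP dom]; exists [set e in map edge_at K]; split.
- by apply/subsetP=> e; rewrite inE => /mapP[i /Kins /insS /andP[_ ?] ->].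
- move=> a; rewrite !inE => -[/mapP[i iK ta] /mapP[j jK ha]].
  have /allP/(_ i iK)/allP/(_ j jK)/negP := allP kernels_independent K KK; apply.
  by apply/arrowP; exists a.
- move=> e eS; rewrite inE => eK.
  have: edge_pos e \in iota 0 15 by rewrite mem_iota edge_pos_lt.
  case/dom/or3P => [posK||/hasP[j succ jK]].
  + by rewrite -[e]edge_posK map_f in eK.
  + by rewrite (negPf (posS _ eS)).
  move: succ; rewrite mem_lookup edge_posK.
  case/and3P=> _ _ /arrowP[a ta ha].
  by exists a; rewrite ha inE map_f.
Qed.

Theorem theorem4 :
  chromatic_index petersen = 4 /\
  has_proper_galvin_orientation petersen (chromatic_index petersen).
Proof.
have -> : chromatic_index petersen = 4.
  rewrite /chromatic_index; case: ex_minnP => k colk min4; apply/eqP.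
  rewrite eqn_leq min4 /=; last by apply/existsP; exists phi4; apply: edge_colouring_phi4.
  by rewrite leqNgt; apply: contraL colk; apply: petersen_not_colourable.
split=> //; exists (~: downset), downset, phi4; split.
- by split; [rewrite setUC setUCr | rewrite setIC setICr].
- exact: edge_colouring_phi4.
- by split; [apply: kernel_perfect_petersen | apply: outdegree_le3].
Qed.
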